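(* Let $\alpha>1$ and $\beta\in\mathbb{R}$. Then: (1) There exists an $\alpha$-admissible sequence with phase sequence converging to a cycle if and only if $\alpha$ has the Pisot property. Moreover, in that case there exists an $\alpha$-admissible sequence with phase sequence converging to $0$. (2)(a) If there exists an $(\alpha,\beta)$-admissible sequence with phase sequence converging to a periodic cycle, then $\alpha$ has the Pisot property. (2)(b) Conversely, if $\alpha$ has the Pisot property and $\beta=\frac{\alpha-1}{\ln\alpha}\,\frac{k_1}{k_2}$, where $k_1$ and $k_2$ are coprime integers with $k_2\ge1$, then there exists an $(\alpha,\beta)$-admissible sequence whose phase sequence converges to a cycle of period $k_2$.
   Context: Given real $\alpha>1$ and $\beta\in\mathbb{R}$, a strictly increasing sequence of positive integers $(n_k)_{k\ge0}$ is $(\alpha,\beta)$-admissible if its phase sequence $\sigma_k:=n_{k+1}-\alpha n_k-\beta\ln n_k$ is bounded. When $\beta=0$ the sequence is called $\alpha$-admissible. A sequence $(\sigma_k)_{k\ge0}$ converges to a cycle of period $\ell\ge1$ if the subsequence $(\sigma_{k\ell+j})_{k\ge0}$ converges for every $0\le j<\ell$; it converges to a (periodic) cycle if this holds for some $\ell$. A real number $\alpha>1$ has the Pisot property if there exists a nonzero real number $\zeta$ such that $\|\zeta\alpha^k\|\to0$ as $k\to\infty$, where $\|\cdot\|$ denotes the distance to the nearest integer. *)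

(* Defs.v *)
From Stdlib Require Import Reals Lra Lia ZArith.
From Coquelicot Require Import Coquelicot.
Open Scope R_scope.

Definition phase (alpha beta : R) (n : nat -> nat) (k : nat) : R :=
  INR (n (S k)) - alpha * INR (n k) - beta * ln (INR (n k)).

Definition admissible (alpha beta : R) (n : nat -> nat) : Prop :=
  (forall k, (0 < n k)%nat) /\
  (forall k, (n k < n (S k))%nat) /\
  (exists M : R, forall k, Rabs (phase alpha beta n k) <= M).

(* The period [l] is not required to be minimal. *)
Definition cvg_cycle_period (s : nat -> R) (l : nat) : Prop :=
  (1 <= l)%nat /\
  forall j : nat, (j < l)%nat ->
    ex_finite_lim_seq (fun k : nat => s (k * l + j)%nat).

Definition cvg_cycle (s : nat -> R) : Prop :=
  exists l : nat, cvg_cycle_period s l.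

Definition dist_int (x : R) : R := Rmin (frac_part x) (1 - frac_part x).

Lemma dist_int_le (x : R) (z : Z) : dist_int x <= Rabs (x - IZR z).
Proof.
unfold dist_int, frac_part.
destruct (base_Int_part x) as [H1 H2].
destruct (Z_le_gt_dec z (Int_part x)) as [H|H].
- apply IZR_le in H.
  apply Rle_trans with (1 := Rmin_l _ _).
  apply Rle_trans with (2 := Rle_abs _); lra.
- assert (H' : (Int_part x + 1 <= z)%Z) by lia.
  apply IZR_le in H'; rewrite plus_IZR in H'.
  apply Rle_trans with (1 := Rmin_r _ _).
  rewrite Rabs_minus_sym.
  apply Rle_trans with (2 := Rle_abs _); lra.
Qed.

Lemma dist_int_attained (x : R) : exists z : Z, dist_int x = Rabs (x - IZR z).
Proof.
unfold dist_int, frac_part.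
destruct (base_Int_part x) as [H1 H2].
apply Rmin_case.
- exists (Int_part x); rewrite Rabs_pos_eq; lra.
- exists (Int_part x + 1)%Z; rewrite plus_IZR, Rabs_minus_sym, Rabs_pos_eq; lra.
Qed.

Definition pisot_property (alpha : R) : Prop :=
  exists zeta : R, zeta <> 0 /\
    is_lim_seq (fun k : nat => dist_int (zeta * alpha ^ k)) 0.

(* Main.v *)
Require Import Defs.
From Stdlib Require Import Reals ZArith Lra Lia.
From Coquelicot Require Import Coquelicot.
Open Scope R_scope.

(** If the phase sequence converges to a cycle of period [l], the integers
    [m k = n (k + l) - n k] satisfy [m (k+1) - alpha * m k -> beta * l * ln alpha],
    so their differences [d k] satisfy [d (k+1) - alpha * d k -> 0]. This forces
    [d k - zeta * alpha ^ k -> 0] for some [zeta], and [zeta = 0] would make the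
    integers [d k] eventually zero, contradicting the exponential growth of [n].

    Conversely, let [z k] be the integer nearest to [zeta * alpha ^ k] with
    [zeta > 0]. Since [ln (z k) = k * ln alpha + ln zeta + o(1)], the correction
    [n k = z k - floor (k * k1 / k2)] absorbs the linear growth of
    [beta * ln (n k)] up to a term that is periodic of period [k2]. *)

(** * Limits of real sequences, in particular against geometric growth *)

Lemma is_lim_seq_ext_eq (u v : nat -> R) (a b : R) :
  (forall k, u k = v k) -> a = b -> is_lim_seq u a -> is_lim_seq v b.
Proof.
intros E <- H; exact (is_lim_seq_ext _ _ _ E H).
Qed.

Lemma is_lim_seq_squeeze_0 (u v : nat -> R) :
  (forall k, Rabs (u k) <= v k) -> is_lim_seq v 0 -> is_lim_seq u 0.
Proof.
intros H Hv; apply is_lim_seq_abs_0.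
apply is_lim_seq_le_le with (fun _ => 0) v; auto.
- intros k; split; [apply Rabs_pos | apply H].
- apply is_lim_seq_const.
Qed.

Lemma is_lim_seq_bounded (u : nat -> R) (l : R) :
  is_lim_seq u l -> exists M, forall k, Rabs (u k) <= M.
Proof.
intros H.
destruct (filterlim_bounded (K := R_AbsRing) (V := R_NormedModule) u) as [M HM].
- exists l; exact H.
- exists M; exact HM.
Qed.

Lemma is_lim_seq_ln (u : nat -> R) (l : R) :
  0 < l -> is_lim_seq u l -> is_lim_seq (fun k => ln (u k)) (ln l).
Proof.
intros Hl; apply is_lim_seq_continuous.
apply continuity_pt_filterlim; exact (continuous_ln l Hl).
Qed.

Lemma is_lim_seq_ln_div (u : nat -> R) :
  is_lim_seq u p_infty -> is_lim_seq (fun k => ln (u k) / u k) 0.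
Proof.
intros H.
apply (is_lim_comp_seq (fun y => ln y / y) u p_infty 0); auto.
- exact is_lim_div_ln_p.
- exists O; discriminate.
Qed.

Lemma is_lim_seq_pos_mult_p (u v : nat -> R) (l : R) :
  0 < l -> is_lim_seq u l -> is_lim_seq v p_infty ->
  is_lim_seq (fun k => u k * v k) p_infty.
Proof.
intros Hl Hu Hv; apply is_lim_seq_mult with (1 := Hu) (2 := Hv).
apply is_Rbar_mult_sym, is_Rbar_mult_p_infty_pos; exact Hl.
Qed.

Lemma is_lim_seq_div_pow (a : R) (u : nat -> R) (l : R) :
  1 < a -> is_lim_seq u l -> is_lim_seq (fun k => u k / a ^ k) 0.
Proof.
intros Ha Hu.
apply is_lim_seq_div with (1 := Hu) (2 := is_lim_seq_geom_p a Ha).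
- discriminate.
- unfold is_Rbar_div, is_Rbar_mult; simpl; do 2 f_equal; ring.
Qed.

(** This is [ln y / y -> 0] along [y = a ^ k], rescaled by [/ ln a], because
    [ln (a ^ k) = k * ln a]. *)
Lemma is_lim_seq_INR_div_pow (a : R) :
  1 < a -> is_lim_seq (fun k => INR k / a ^ k) 0.
Proof.
intros Ha.
assert (Hl : 0 < ln a) by (rewrite <- ln_1; apply ln_increasing; lra).
assert (H := is_lim_seq_ln_div _ (is_lim_seq_geom_p a Ha)).
apply (is_lim_seq_scal_l _ (/ ln a)) in H; simpl in H.
apply is_lim_seq_ext_eq with (3 := H); [intros k | ring].
assert (0 < a ^ k) by (apply pow_lt; lra).
rewrite ln_pow by lra; field; lra.
Qed.

(** There are finitely many residues, so one threshold [N] serves them all; Euclidean division by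
    [l] then places every index [k >= N * l] in its progression. *)
Lemma is_lim_seq_arith_progressions (u : nat -> R) (l : nat) (x : R) :
  (1 <= l)%nat ->
  (forall j, (j < l)%nat -> is_lim_seq (fun k => u (k * l + j)%nat) x) ->
  is_lim_seq u x.
Proof.
intros Hl H; apply is_lim_seq_spec; intros eps.
assert (K : forall m, (m <= l)%nat -> exists N, forall j k,
  (j < m)%nat -> (N <= k)%nat -> Rabs (u (k * l + j)%nat - x) < eps).
{ induction m as [|m IH]; intros Hm.
  - exists O; lia.
  - destruct IH as [N HN]; [lia|].
    assert (H1 := H m Hm); apply is_lim_seq_spec in H1.
    destruct (H1 eps) as [N' HN'].
    exists (N + N')%nat; intros j k Hj Hk.
    destruct (Nat.eq_dec j m) as [->|Hjm].
    + apply HN'; lia.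
    + apply HN; lia. }
destruct (K l (le_n l)) as [N HN].
exists (N * l)%nat; intros k Hk.
rewrite (Nat.div_mod_eq k l), (Nat.mul_comm l).
apply HN.
- apply Nat.mod_upper_bound; lia.
- apply Nat.div_le_lower_bound; lia.
Qed.

(** A shift by [l] keeps the residue class and advances one step in it, so both terms have the same
    limit along each class. *)
Lemma cvg_cycle_period_shift_diff (s : nat -> R) (l : nat) :
  cvg_cycle_period s l -> is_lim_seq (fun k => s (k + l)%nat - s k) 0.
Proof.
intros [Hl H]; apply is_lim_seq_arith_progressions with l; auto.
intros j Hj; destruct (H j Hj) as [x Hx].
apply is_lim_seq_ext_eq with
  (fun k => s (S k * l + j)%nat - s (k * l + j)%nat) (x - x); [|ring|].
- intros k; do 2 f_equal; lia.
- apply is_lim_seq_minus'; auto.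
  apply (is_lim_seq_incr_1 (fun k => s (k * l + j)%nat)); exact Hx.
Qed.

(** * Perturbed geometric recurrences and integer sequences *)

(** The quotients [d k / a ^ k] have increments that are [o(a ^ -k)], so they converge to some
    [zeta]. The tails of the increments are again [o(a ^ -k)], which is what survives multiplication
    by [a ^ k]. *)
Lemma linear_recurrence_asymptotics (a : R) (d : nat -> R) :
  1 < a -> is_lim_seq (fun k => d (S k) - a * d k) 0 ->
  exists zeta, is_lim_seq (fun k => d k - zeta * a ^ k) 0.
Proof.
intros Ha H; apply is_lim_seq_spec in H.
assert (Hp : forall k, 0 < a ^ k) by (intros k; apply pow_lt; lra).
set (x := fun k => d k / a ^ k).
assert (T : forall eps : posreal, exists N, forall k p, (N <= k)%nat ->
  Rabs (x (k + p)%nat - x k) <= eps / a ^ k).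
{ intros eps.
  assert (He : 0 < eps * (a - 1))
    by (apply Rmult_lt_0_compat; [apply cond_pos | lra]).
  destruct (H (mkposreal _ He)) as [N HN]; simpl in HN.
  exists N; intros k p Hk.
  (* The bounds telescope: (a - 1) / a^(j+1) = 1 / a^j - 1 / a^(j+1). *)
  apply Rle_trans with (eps * (/ a ^ k - / a ^ (k + p))).
  - induction p as [|p IH].
    + rewrite Nat.add_0_r, !Rminus_diag, Rabs_R0; lra.
    + rewrite Nat.add_succ_r.
      replace (x (S (k + p)) - x k) with
        ((d (S (k + p)) - a * d (k + p)%nat) / a ^ (S (k + p)) +
         (x (k + p)%nat - x k)).
      2:{ unfold x; simpl; assert (P := Hp (k + p)%nat); assert (P' := Hp k).
          field; lra. }
      apply Rle_trans with (1 := Rabs_triang _ _).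
      assert (B : Rabs ((d (S (k + p)) - a * d (k + p)%nat) / a ^ (S (k + p)))
                  <= eps * (/ a ^ (k + p) - / a ^ (S (k + p)))).
      { unfold Rdiv; rewrite Rabs_mult, (Rabs_pos_eq (/ _))
          by (left; apply Rinv_0_lt_compat, Hp).
        replace (eps * (/ a ^ (k + p) - / a ^ (S (k + p)))) with
          (eps * (a - 1) * / a ^ (S (k + p))).
        2:{ simpl; assert (P := Hp (k + p)%nat); field; lra. }
        apply Rmult_le_compat_r; [left; apply Rinv_0_lt_compat, Hp|].
        left; rewrite <- (Rminus_0_r (_ - _)); apply HN; lia. }
      lra.
  - unfold Rdiv; apply Rmult_le_compat_l; [left; apply cond_pos|].
    assert (0 < / a ^ (k + p)) by (apply Rinv_0_lt_compat, Hp); lra. }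
assert (C : ex_finite_lim_seq x).
{ apply ex_lim_seq_cauchy_corr; intros eps.
  assert (He : 0 < eps / 4) by (assert (P := cond_pos eps); lra).
  destruct (T (mkposreal _ He)) as [N HN]; simpl in HN.
  assert (B : forall k, (N <= k)%nat -> Rabs (x k - x N) <= eps / 4).
  { intros k Hk; replace k with (N + (k - N))%nat by lia.
    apply Rle_trans with (1 := HN N _ (le_n N)).
    rewrite <- (Rdiv_1_r (eps / 4)) at 2; unfold Rdiv at 1 3.
    apply Rmult_le_compat_l; [lra|].
    apply Rinv_le_contravar; [lra|]; apply pow_R1_Rle; lra. }
  exists N; intros p q Hp' Hq.
  replace (x p - x q) with ((x p - x N) - (x q - x N)) by ring.
  apply Rle_lt_trans with (1 := Rabs_triang _ _); rewrite Rabs_Ropp.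
  assert (B1 := B p Hp'); assert (B2 := B q Hq); assert (P := cond_pos eps).
  lra. }
destruct C as [zeta Hz]; exists zeta.
apply is_lim_seq_spec; intros eps.
assert (He : 0 < eps / 2) by (assert (P := cond_pos eps); lra).
destruct (T (mkposreal _ He)) as [N HN]; simpl in HN.
exists N; intros k Hk.
(* Letting [p] tend to infinity in [T] bounds the whole tail; [eps / 2] restores the strict
   inequality lost in the limit. *)
assert (B : Rabs (zeta - x k) <= eps / 2 / a ^ k).
{ change (Rbar_le (Rabs (zeta - x k)) (eps / 2 / a ^ k)).
  apply is_lim_seq_le with
    (fun p => Rabs (x (p + k)%nat - x k)) (fun _ => eps / 2 / a ^ k).
  - intros p; rewrite Nat.add_comm; apply HN; exact Hk.
  - apply (is_lim_seq_abs _ (zeta - x k)), is_lim_seq_minus';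
      [|apply is_lim_seq_const].
    apply (is_lim_seq_incr_n x k); exact Hz.
  - apply is_lim_seq_const. }
rewrite Rminus_0_r.
replace (d k - zeta * a ^ k) with (- ((zeta - x k) * a ^ k)).
2:{ unfold x; assert (P := Hp k); field; lra. }
rewrite Rabs_Ropp, Rabs_mult, (Rabs_pos_eq (a ^ k)) by (left; apply Hp).
apply Rle_lt_trans with (eps / 2 / a ^ k * a ^ k).
- apply Rmult_le_compat_r; [left; apply Hp | exact B].
- assert (P := Hp k); assert (P' := cond_pos eps); field_simplify; lra.
Qed.

Lemma is_lim_seq_IZR_0 (d : nat -> Z) :
  is_lim_seq (fun k => IZR (d k)) 0 -> eventually (fun k => d k = 0%Z).
Proof.
intros H; apply is_lim_seq_spec in H.
destruct (H (mkposreal 1 Rlt_0_1)) as [N HN]; simpl in HN.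
exists N; intros k Hk; specialize (HN k Hk).
rewrite Rminus_0_r, <- abs_IZR in HN; apply lt_IZR in HN; lia.
Qed.

(** * The Pisot property through integer approximations *)

Lemma dist_int_ge_0 (x : R) : 0 <= dist_int x.
Proof.
destruct (dist_int_attained x) as [z ->]; apply Rabs_pos.
Qed.

Lemma pisot_property_intro (a zeta : R) (z : nat -> Z) :
  zeta <> 0 -> is_lim_seq (fun k => IZR (z k) - zeta * a ^ k) 0 ->
  pisot_property a.
Proof.
intros Hz H; exists zeta; split; [exact Hz|].
apply is_lim_seq_abs_0 in H.
apply is_lim_seq_squeeze_0 with (2 := H).
intros k; rewrite (Rabs_pos_eq (dist_int _)) by apply dist_int_ge_0.
rewrite Rabs_minus_sym; apply dist_int_le.
Qed.

(** The test is the comparison made by [Rmin] in [dist_int], so a single case split resolves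
    both. *)
Definition nearest_int (x : R) : Z :=
  if Rle_dec (frac_part x) (1 - frac_part x)
  then Int_part x else (Int_part x + 1)%Z.

Lemma nearest_int_spec (x : R) : Rabs (IZR (nearest_int x) - x) = dist_int x.
Proof.
unfold nearest_int, dist_int, Rmin; rewrite Rabs_minus_sym.
destruct (base_Int_part x) as [H1 H2].
destruct Rle_dec; unfold frac_part.
- rewrite Rabs_pos_eq; lra.
- rewrite plus_IZR, Rabs_minus_sym, Rabs_pos_eq; lra.
Qed.

(** A negative [zeta] is handled by negating both [zeta] and the integers. Positivity lets the
    integers tend to plus infinity and [ln zeta] be a genuine logarithm. *)
Lemma pisot_property_pos_approx (a : R) :
  pisot_property a -> exists (zeta : R) (z : nat -> Z),
    0 < zeta /\ is_lim_seq (fun k => IZR (z k) - zeta * a ^ k) 0.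
Proof.
intros (zeta & Hz & H).
assert (H' : is_lim_seq
  (fun k => IZR (nearest_int (zeta * a ^ k)) - zeta * a ^ k) 0).
{ apply is_lim_seq_squeeze_0 with (2 := H).
  intros k; rewrite nearest_int_spec; lra. }
destruct (Rtotal_order zeta 0) as [Hn|[H0|Hp]]; [|contradiction|].
- exists (- zeta), (fun k => (- nearest_int (zeta * a ^ k))%Z); split; [lra|].
  apply is_lim_seq_opp in H'; simpl in H'.
  apply is_lim_seq_ext_eq with (3 := H'); [intros k; rewrite opp_IZR|]; ring.
- exists zeta, (fun k => nearest_int (zeta * a ^ k)); auto.
Qed.

(** * Growth of admissible sequences and necessity of the Pisot property *)

Section AdmissibleGrowth.

Variables (alpha beta : R) (n : nat -> nat).
Hypotheses (halpha : 1 < alpha) (hn : admissible alpha beta n).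

Lemma admissible_cvg_infty : is_lim_seq (fun k => INR (n k)) p_infty.
Proof.
destruct hn as (_ & Hi & _).
apply is_lim_seq_le_p_loc with INR; [|apply is_lim_seq_INR].
exists O; intros k _; apply le_INR.
induction k as [|k IH]; [lia | specialize (Hi k); lia].
Qed.

(** Divide [n (k+1) = alpha * n k + beta * ln (n k) + phase] by [n k]: the logarithmic and the
    bounded terms vanish. *)
Lemma admissible_ratio :
  is_lim_seq (fun k => INR (n (S k)) / INR (n k)) alpha.
Proof.
assert (Hinf := admissible_cvg_infty).
destruct hn as (Hpos & _ & M & HM).
assert (Hp : forall k, 0 < INR (n k)) by (intros k; apply lt_0_INR, Hpos).
assert (Hs : is_lim_seq (fun k => phase alpha beta n k / INR (n k)) 0).
{ apply is_lim_seq_squeeze_0 with (fun k => M * / INR (n k)).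
  - intros k; assert (0 < / INR (n k)) by (apply Rinv_0_lt_compat, Hp).
    unfold Rdiv; rewrite Rabs_mult, (Rabs_pos_eq (/ _)) by lra.
    apply Rmult_le_compat_r; [lra | apply HM].
  - apply is_lim_seq_inv in Hinf; [|discriminate].
    apply (is_lim_seq_scal_l _ M) in Hinf; simpl in Hinf.
    rewrite Rmult_0_r in Hinf; exact Hinf. }
assert (Hl := is_lim_seq_ln_div _ Hinf).
apply (is_lim_seq_scal_l _ beta) in Hl; simpl in Hl.
assert (H := is_lim_seq_plus' _ _ _ _ (is_lim_seq_const alpha)
               (is_lim_seq_plus' _ _ _ _ Hl Hs)).
apply is_lim_seq_ext_eq with (3 := H); [intros k | ring].
specialize (Hp k); unfold phase; field; lra.
Qed.

Lemma admissible_ln_diff (l : nat) :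
  is_lim_seq (fun k => ln (INR (n (k + l)%nat)) - ln (INR (n k)))
    (INR l * ln alpha).
Proof.
assert (Hp : forall k, 0 < INR (n k)) by (intros k; apply lt_0_INR, hn).
induction l as [|l IH].
- apply is_lim_seq_ext_eq with (3 := is_lim_seq_const 0); [intros k|simpl; ring].
  rewrite Nat.add_0_r; ring.
- assert (H := is_lim_seq_ln _ alpha ltac:(lra) admissible_ratio).
  apply (is_lim_seq_incr_n _ l) in H.
  assert (H' := is_lim_seq_plus' _ _ _ _ IH H).
  apply is_lim_seq_ext_eq with (3 := H'); [intros k | rewrite S_INR; ring].
  rewrite ln_div by apply Hp; rewrite Nat.add_succ_r; ring.
Qed.

Lemma admissible_gap_cvg_infty :
  is_lim_seq (fun k => INR (n (S k)) - INR (n k)) p_infty.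
Proof.
assert (H := is_lim_seq_minus' _ _ _ _ admissible_ratio (is_lim_seq_const 1)).
apply is_lim_seq_ext with (2 :=
  is_lim_seq_pos_mult_p _ _ (alpha - 1) ltac:(lra) H admissible_cvg_infty).
intros k; assert (0 < INR (n k)) by apply lt_0_INR, hn; field; lra.
Qed.

Lemma admissible_cvg_cycle_pisot :
  cvg_cycle (phase alpha beta n) -> pisot_property alpha.
Proof.
intros (l & Hc).
assert (Hl : (1 <= l)%nat) by apply Hc.
set (m := fun k => (Z.of_nat (n (k + l)%nat) - Z.of_nat (n k))%Z).
set (d := fun k => (m (S k) - m k)%Z).
assert (Em : forall k, IZR (m k) = INR (n (k + l)%nat) - INR (n k))
  by (intros k; unfold m; rewrite minus_IZR, <- !INR_IZR_INZ; reflexivity).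
(* The left side is the phase at [k + l] minus the phase at [k], plus [beta] times the difference of
   logarithms. *)
assert (Hm : is_lim_seq (fun k => IZR (m (S k)) - alpha * IZR (m k))
               (beta * (INR l * ln alpha) + 0)).
{ assert (H := is_lim_seq_plus' _ _ _ _
    (is_lim_seq_mult' _ _ _ _ (is_lim_seq_const beta) (admissible_ln_diff l))
    (cvg_cycle_period_shift_diff _ _ Hc)).
  apply is_lim_seq_ext with (2 := H).
  intros k; rewrite !Em; unfold phase; simpl; ring. }
assert (Hd : is_lim_seq (fun k => IZR (d (S k)) - alpha * IZR (d k)) 0).
{ assert (Hm' := Hm); apply is_lim_seq_incr_1 in Hm'.
  assert (H := is_lim_seq_minus' _ _ _ _ Hm' Hm).
  apply is_lim_seq_ext_eq with (3 := H); [intros k | ring].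
  unfold d; rewrite !minus_IZR; ring. }
destruct (linear_recurrence_asymptotics alpha (fun k => IZR (d k)) halpha Hd)
  as [zeta Hz].
apply pisot_property_intro with (2 := Hz).
(* If [zeta = 0], then [d] is eventually zero and [m] eventually constant. Since [l >= 1],
   monotonicity gives [m k >= n (k+1) - n k], which is unbounded. *)
intros ->.
assert (H0 : is_lim_seq (fun k => IZR (d k)) 0)
  by (apply is_lim_seq_ext with (2 := Hz); intros k; ring).
destruct (is_lim_seq_IZR_0 d H0) as [N HN].
assert (Hconst : forall k, (N <= k)%nat -> m k = m N).
{ intros k Hk; induction Hk as [|k Hk IH]; [reflexivity|].
  specialize (HN k Hk); unfold d in HN; lia. }
assert (Hg := admissible_gap_cvg_infty); apply is_lim_seq_spec in Hg.
destruct (Hg (IZR (m N))) as [N' HN'].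
specialize (HN' (N + N')%nat ltac:(lia)).
rewrite <- (Hconst (N + N')%nat), Em in HN' by lia.
assert (Hmono : forall p k, INR (n k) <= INR (n (k + p)%nat)).
{ intros p k; apply le_INR; induction p as [|p IH].
  - rewrite Nat.add_0_r; lia.
  - destruct hn as (_ & Hi & _); specialize (Hi (k + p)%nat).
    rewrite Nat.add_succ_r; lia. }
specialize (Hmono (l - 1)%nat (S (N + N'))).
replace (S (N + N') + (l - 1))%nat with (N + N' + l)%nat in Hmono by lia.
lra.
Qed.

End AdmissibleGrowth.

(** * Construction of admissible sequences from the Pisot property *)

(* The phase is compared with the bounded sequence [s], which measures how far
   the integer correction [c] is from solving [c (k+1) - alpha * c k = beta * k * ln alpha]. *)
Lemma pisot_admissible_perturbation (alpha beta : R) (c : nat -> Z)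
    (s : nat -> R) (B : R) (l : nat) :
  1 < alpha -> pisot_property alpha -> (1 <= l)%nat ->
  is_lim_seq (fun k => IZR (c k) / alpha ^ k) 0 ->
  (forall k, IZR (c (S k)) - alpha * IZR (c k) - beta * (INR k * ln alpha) = s k) ->
  (forall k, Rabs (s k) <= B) ->
  exists (n : nat -> nat) (zeta : R) (K : nat),
    admissible alpha beta n /\
    is_lim_seq (fun k => phase alpha beta n k - s (k + K * l)%nat)
      (- (beta * ln zeta)).
Proof.
intros Ha HP Hl Hc Hs HB.
destruct (pisot_property_pos_approx alpha HP) as (zeta & z & Hz0 & Hz).
assert (Hp : forall k, 0 < alpha ^ k) by (intros k; apply pow_lt; lra).
assert (Hgeom := is_lim_seq_geom_p alpha Ha).
set (f := fun k => (z k + c k)%Z).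
assert (Hratio : is_lim_seq (fun k => IZR (f k) / alpha ^ k) zeta).
{ assert (H := is_lim_seq_plus' _ _ _ _ (is_lim_seq_const zeta)
    (is_lim_seq_plus' _ _ _ _ (is_lim_seq_div_pow alpha _ _ Ha Hz) Hc)).
  apply is_lim_seq_ext_eq with (3 := H); [intros k | ring].
  unfold f; rewrite plus_IZR; specialize (Hp k); field; lra. }
assert (Hinf : is_lim_seq (fun k => IZR (f k)) p_infty).
{ apply is_lim_seq_ext with (2 :=
    is_lim_seq_pos_mult_p _ _ zeta Hz0 Hratio Hgeom).
  intros k; specialize (Hp k); field; lra. }
(* The gap divided by [alpha ^ k] tends to [(alpha - 1) * zeta > 0]. *)
assert (Hgap : is_lim_seq (fun k => IZR (f (S k)) - IZR (f k)) p_infty).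
{ assert (H1 := Hratio); apply is_lim_seq_incr_1 in H1.
  assert (H := is_lim_seq_minus' _ _ _ _
    (is_lim_seq_mult' _ _ _ _ (is_lim_seq_const alpha) H1) Hratio).
  assert (Hpos : 0 < alpha * zeta - zeta).
  { replace (alpha * zeta - zeta) with ((alpha - 1) * zeta) by ring.
    apply Rmult_lt_0_compat; lra. }
  apply is_lim_seq_ext with (2 := is_lim_seq_pos_mult_p _ _ _ Hpos H Hgeom).
  intros k; specialize (Hp k); simpl; field; lra. }
apply is_lim_seq_spec in Hgap; destruct (Hgap 0) as [N1 HN1].
assert (Hinf' := Hinf); apply is_lim_seq_spec in Hinf'.
destruct (Hinf' 0) as [N2 HN2].
assert (Hln : is_lim_seq (fun k => ln (IZR (f k)) - INR k * ln alpha) (ln zeta)).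
{ apply is_lim_seq_ext_loc with (2 := is_lim_seq_ln _ _ Hz0 Hratio).
  exists N2; intros k Hk.
  rewrite ln_div, ln_pow; auto; lra. }
(* Subtracting [s k] cancels the terms in [c]. What remains is [z (k+1) - alpha * z k], which tends
   to 0, and [- beta * (ln (f k) - k * ln alpha)]. *)
assert (Hph : is_lim_seq (fun k =>
  IZR (f (S k)) - alpha * IZR (f k) - beta * ln (IZR (f k)) - s k)
  (- (beta * ln zeta))).
{ assert (H1 := Hz); apply is_lim_seq_incr_1 in H1.
  assert (H := is_lim_seq_minus' _ _ _ _
    (is_lim_seq_minus' _ _ _ _ H1
      (is_lim_seq_mult' _ _ _ _ (is_lim_seq_const alpha) Hz))
    (is_lim_seq_mult' _ _ _ _ (is_lim_seq_const beta) Hln)).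
  apply is_lim_seq_ext_eq with (3 := H); [intros k | ring].
  rewrite <- Hs; unfold f; rewrite !plus_IZR; simpl; ring. }
(* Beyond [K], [f] is positive and strictly increasing. The sequence starts at the multiple [K * l]
   so that the shift leaves an [l]-periodic [s] unchanged. *)
set (K := (N1 + N2)%nat).
assert (HK : (K <= K * l)%nat) by nia.
set (n := fun k => Z.to_nat (f (k + K * l)%nat)).
assert (Hfpos : forall k, (0 < f (k + K * l)%nat)%Z)
  by (intros k; apply lt_IZR, HN2; lia).
assert (En : forall k, INR (n k) = IZR (f (k + K * l)%nat)).
{ intros k; unfold n; rewrite INR_IZR_INZ, Z2Nat.id; [reflexivity|].
  specialize (Hfpos k); lia. }
assert (Hlim : is_lim_seq (fun k => phase alpha beta n k - s (k + K * l)%nat)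
                 (- (beta * ln zeta))).
{ apply (is_lim_seq_incr_n _ (K * l)) in Hph.
  apply is_lim_seq_ext with (2 := Hph).
  intros k; unfold phase; rewrite !En; reflexivity. }
exists n, zeta, K; split; [|exact Hlim].
split; [|split].
- intros k; apply INR_lt; rewrite En; apply (IZR_lt 0), Hfpos.
- intros k; apply INR_lt; rewrite !En.
  specialize (HN1 (k + K * l)%nat ltac:(lia)); simpl in *; lra.
- destruct (is_lim_seq_bounded _ _ Hlim) as [M HM].
  exists (M + B); intros k.
  replace (phase alpha beta n k) with
    ((phase alpha beta n k - s (k + K * l)%nat) + s (k + K * l)%nat) by ring.
  apply Rle_trans with (1 := Rabs_triang _ _).
  apply Rplus_le_compat; [apply HM | apply HB].
Qed.

Lemma pisot_admissible_phase_0 (alpha : R) :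
  1 < alpha -> pisot_property alpha ->
  exists n, admissible alpha 0 n /\ is_lim_seq (phase alpha 0 n) 0.
Proof.
intros Ha HP.
destruct (pisot_admissible_perturbation alpha 0 (fun _ => 0%Z) (fun _ => 0) 0 1)
  as (n & zeta & K & Hn & Hlim); auto.
- apply is_lim_seq_ext_eq with (3 := is_lim_seq_const 0); [intros k|]; lra.
- intros k; ring.
- intros k; rewrite Rabs_R0; lra.
- exists n; split; auto.
  apply is_lim_seq_ext_eq with (3 := Hlim); [intros k|]; ring.
Qed.

(** With [q = k1 / k2], the choice of [beta] gives [beta * ln alpha = (alpha - 1) * q], so [- k * q]
    solves the equation for [c] up to the constant [- q]. Rounding to an integer adds the fractional
    part of [k * q], which has period [k2]. *)
Lemma pisot_admissible_cycle (alpha : R) (k1 k2 : Z) :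
  1 < alpha -> (1 <= k2)%Z -> pisot_property alpha ->
  let beta := (alpha - 1) / ln alpha * (IZR k1 / IZR k2) in
  exists n, admissible alpha beta n /\
    cvg_cycle_period (phase alpha beta n) (Z.to_nat k2).
Proof.
intros Ha Hk2 HP beta.
set (q := IZR k1 / IZR k2).
assert (Hk2' : 1 <= IZR k2) by (apply IZR_le; exact Hk2).
assert (Hla : 0 < ln alpha) by (rewrite <- ln_1; apply ln_increasing; lra).
(* [c k] is minus the floor of [k * q], and [p k] is the fractional part of [k * q]. *)
set (c := fun k => (- (Z.of_nat k * k1 / k2))%Z).
set (p := fun k => IZR ((Z.of_nat k * k1) mod k2) / IZR k2).
set (s := fun k => p (S k) - alpha * p k - q).
assert (Ec : forall k, IZR (c k) = p k - INR k * q).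
{ intros k; unfold c, p, q; rewrite opp_IZR, INR_IZR_INZ.
  assert (E := Z.div_mod (Z.of_nat k * k1) k2 ltac:(lia)).
  apply (f_equal IZR) in E; rewrite plus_IZR, !mult_IZR in E.
  apply Rmult_eq_reg_r with (IZR k2); [|lra].
  field_simplify; lra. }
assert (Bp : forall k, 0 <= p k <= 1).
{ intros k; unfold p.
  destruct (Z.mod_pos_bound (Z.of_nat k * k1) k2 ltac:(lia)) as [H1 H2].
  apply IZR_le in H1; apply IZR_lt in H2; split.
  - apply Rdiv_le_0_compat; lra.
  - apply Rmult_le_reg_r with (IZR k2); [lra|]; field_simplify; lra. }
assert (Pp : forall i k, p (k + i * Z.to_nat k2)%nat = p k).
{ intros i k; unfold p; do 2 f_equal.
  rewrite Nat2Z.inj_add, Nat2Z.inj_mul, Z2Nat.id by lia.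
  rewrite <- (Z_mod_plus_full (Z.of_nat k * k1) (Z.of_nat i * k1) k2).
  f_equal; ring. }
destruct (pisot_admissible_perturbation alpha beta c s
  (1 + alpha + Rabs q) (Z.to_nat k2)) as (n & zeta & K & Hn & Hlim); auto; try lia.
- assert (Hp1 : is_lim_seq (fun k => p k / alpha ^ k) 0).
  { apply is_lim_seq_squeeze_0 with (2 :=
      is_lim_seq_div_pow alpha _ _ Ha (is_lim_seq_const 1)).
    intros k; assert (0 < / alpha ^ k) by (apply Rinv_0_lt_compat, pow_lt; lra).
    specialize (Bp k); unfold Rdiv.
    rewrite Rabs_pos_eq by (apply Rmult_le_pos; lra).
    apply Rmult_le_compat_r; lra. }
  assert (H := is_lim_seq_minus' _ _ _ _ Hp1
    (is_lim_seq_mult' _ _ _ _ (is_lim_seq_const q)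
       (is_lim_seq_INR_div_pow alpha Ha))).
  apply is_lim_seq_ext_eq with (3 := H); [intros k | ring].
  rewrite Ec; unfold Rdiv; ring.
- intros k; rewrite !Ec, S_INR; unfold s, beta; fold q; field; lra.
- intros k; unfold s.
  assert (B1 := Bp k); assert (B2 := Bp (S k)).
  assert (B3 : 0 <= alpha * p k <= alpha)
    by (split; [apply Rmult_le_pos | rewrite <- (Rmult_1_r alpha) at 2;
        apply Rmult_le_compat_l]; lra).
  assert (Q1 := Rle_abs q); assert (Q2 := Rle_abs (- q)); rewrite Rabs_Ropp in Q2.
  apply Rabs_le; lra.
- exists n; split; [exact Hn|]; split; [lia|].
  (* By periodicity [s] equals [s j] at every index used in this residue class, so the limit is that
     of the difference plus [s j]. *)
  intros j _; exists (- (beta * ln zeta) + s j).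
  assert (Hsub : is_lim_seq (fun k => phase alpha beta n (k * Z.to_nat k2 + j) -
    s (k * Z.to_nat k2 + j + K * Z.to_nat k2)%nat) (- (beta * ln zeta))).
  { apply (is_lim_seq_subseq _ _ (fun k => (k * Z.to_nat k2 + j)%nat))
      with (2 := Hlim).
    apply eventually_subseq; intros k; lia. }
  assert (H := is_lim_seq_plus' _ _ _ _ Hsub (is_lim_seq_const (s j))).
  apply is_lim_seq_ext with (2 := H); intros k.
  replace (s (k * Z.to_nat k2 + j + K * Z.to_nat k2)%nat) with (s j); [ring|].
  unfold s.
  replace (k * Z.to_nat k2 + j + K * Z.to_nat k2)%nat
    with (j + (k + K) * Z.to_nat k2)%nat by ring.
  rewrite <- Nat.add_succ_l, !Pp; reflexivity.
Qed.

Theorem theorem1p10 (alpha beta : R) (halpha : 1 < alpha) :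
  (((exists n : nat -> nat,
       admissible alpha 0 n /\ cvg_cycle (phase alpha 0 n))
    <-> pisot_property alpha)
   /\
   (pisot_property alpha ->
     exists n : nat -> nat,
       admissible alpha 0 n /\ is_lim_seq (phase alpha 0 n) 0))
  /\
  ((exists n : nat -> nat,
      admissible alpha beta n /\ cvg_cycle (phase alpha beta n)) ->
    pisot_property alpha)
  /\
  (forall k1 k2 : Z,
    Z.gcd k1 k2 = 1%Z -> (1 <= k2)%Z ->
    pisot_property alpha ->
    beta = (alpha - 1) / ln alpha * (IZR k1 / IZR k2) ->
    exists n : nat -> nat,
      admissible alpha beta n /\
      cvg_cycle_period (phase alpha beta n) (Z.to_nat k2)).
Proof.
split; [split; [split|]|split].
- intros (n & Hn & Hc); exact (admissible_cvg_cycle_pisot alpha 0 n halpha Hn Hc).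
- intros HP; destruct (pisot_admissible_phase_0 alpha halpha HP) as (n & Hn & H).
  exists n; split; [exact Hn|].
  exists 1%nat; split; [lia|]; intros j Hj; exists 0.
  apply is_lim_seq_ext with (2 := H); intros k; f_equal; lia.
- apply pisot_admissible_phase_0; exact halpha.
- intros (n & Hn & Hc).
  exact (admissible_cvg_cycle_pisot alpha beta n halpha Hn Hc).
- intros k1 k2 _ Hk2 HP ->; exact (pisot_admissible_cycle alpha k1 k2 halpha Hk2 HP).
Qed.
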